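(* Let $n,t$ be positive integers. If there exists a collection of $t$ mutually orthogonal Latin squares of order $n$, then $\tau_t(K_n^2)=tn$.
   Context: A Latin square of order $n$ is an $n\times n$ array with entries in $[n]$ in which each element of $[n]$ appears exactly once in each row and each column. Two Latin squares $A=(a_{ij})$, $B=(b_{ij})$ are orthogonal if the pairs $(a_{ij},b_{ij})$ for $(i,j)\in[n]^2$ are pairwise distinct; a collection is mutually orthogonal if every pair is orthogonal. $K_n^2$ is the Cartesian product $K_n\times K_n$: vertex set $[n]^2$, two vertices adjacent iff they differ in exactly one coordinate. For an integer $t\ge1$, a $t$-tone coloring of a graph $G$ assigns to each vertex $v$ a set $f(v)$ of exactly $t$ colors from a color set $C$ such that $|f(u)\cap f(v)|<d(u,v)$ for all distinct $u,v$, where $d$ is graph distance; $\tau_t(G)$ is the minimum $|C|$ over all such colorings. *)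

(* Defs.v *)
From mathcomp Require Import all_boot all_algebra.

Set Implicit Arguments.
Unset Strict Implicit.
Unset Printing Implicit Defensive.

(* The symbols, rows and columns [n] = {1, ..., n} are represented by 'I_n. *)
Definition latin_square (n : nat) (A : 'M['I_n]_n) : Prop :=
  (forall (i : 'I_n) (s : 'I_n), exists! j : 'I_n, A i j = s) /\
  (forall (j : 'I_n) (s : 'I_n), exists! i : 'I_n, A i j = s).

Definition orthogonal_squares (n : nat) (A B : 'M['I_n]_n) : Prop :=
  injective (fun x : 'I_n * 'I_n => (A x.1 x.2, B x.1 x.2)).

Definition MOLS (n t : nat) (L : 'I_t -> 'M['I_n]_n) : Prop :=
  (forall k : 'I_t, latin_square (L k)) /\
  (forall k l : 'I_t, k != l -> orthogonal_squares (L k) (L l)).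

Record sgraph := SGraph {
  vertex : finType;
  adj : rel vertex;
  adj_sym : symmetric adj;
  adj_irr : irreflexive adj }.

Section Distance.
Variable G : sgraph.
Implicit Types (u v : vertex G) (k : nat).

Definition has_walk u v k : bool :=
  [exists p : k.-tuple (vertex G), path (@adj G) u p && (last u p == v)].

Lemma connect_has_walk u v :
  connect (@adj G) u v -> exists k, has_walk u v k.
Proof.
case/connectP => p pp ->; exists (size p).
by apply/existsP; exists (in_tuple p); rewrite pp eqxx.
Qed.

(* None stands for an infinite distance. *)
Definition gdist u v : option nat :=
  match decP (@idP (connect (@adj G) u v)) with
  | left uv => Some (ex_minn (connect_has_walk uv))
  | right _ => None
  end.

Definition lt_dist k (d : option nat) : bool :=
  if d is Some m then k < m else true.

Lemma gdist_gt0 u v : u != v -> lt_dist 0 (gdist u v).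
Proof.
move=> uv; rewrite /gdist; case: decP => //= h.
case: ex_minnP => -[|k] // /existsP[p].
by rewrite tuple0 /= (negbTE uv).
Qed.

End Distance.

Definition tone_coloring (G : sgraph) (t : nat) (C : finType)
    (f : {ffun vertex G -> {set C}}) : bool :=
  [forall v, #|f v| == t] &&
  [forall u, forall v, (u != v) ==> lt_dist #|f u :&: f v| (gdist u v)].

Definition tone_colorable (G : sgraph) (t k : nat) : bool :=
  [exists f : {ffun vertex G -> {set 'I_k}}, tone_coloring t f].

Lemma tone_colorable_card (G : sgraph) (t : nat) (C : finType)
    (f : {ffun vertex G -> {set C}}) :
  tone_coloring t f -> tone_colorable G t #|C|.
Proof.
case/andP => /forallP ft /forallP fd; apply/existsP.
exists [ffun v => @enum_rank C @: f v]; apply/andP; split.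
  by apply/forallP => v; rewrite ffunE card_imset //; apply: enum_rank_inj.
apply/forallP => u; apply/forallP => v; apply/implyP => uv.
rewrite !ffunE -imsetI; last by move=> x y _ _; apply: enum_rank_inj.
rewrite card_imset; last exact: enum_rank_inj.
by move: (fd u) => /forallP/(_ v); rewrite uv.
Qed.

Lemma tone_colorable_ex (G : sgraph) (t : nat) :
  exists k, tone_colorable G t k.
Proof.
exists #|{: vertex G * 'I_t}|.
pose f := [ffun v : vertex G => [set (v, i) | i : 'I_t]].
apply: (@tone_colorable_card G t _ f); apply/andP; split.
  apply/forallP => v; rewrite ffunE card_imset ?card_ord //.
  by move=> i j [].
apply/forallP => u; apply/forallP => v; apply/implyP => uv.
suff -> : f u :&: f v = set0 by rewrite cards0 gdist_gt0.
apply/setP => x; rewrite !ffunE !inE.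
apply/negP => /andP[/imsetP[i _ ->] /imsetP[j _ [e _]]].
by rewrite e eqxx in uv.
Qed.

(* tau_t(G). Color sets 'I_k suffice, by tone_colorable_card. *)
Definition tone_number (t : nat) (G : sgraph) : nat :=
  ex_minn (tone_colorable_ex G t).

Definition rook_adj (n : nat) : rel ('I_n * 'I_n) :=
  fun u v => (u.1 != v.1) (+) (u.2 != v.2).

Lemma rook_adj_sym n : symmetric (@rook_adj n).
Proof. by move=> u v; rewrite /rook_adj eq_sym [u.2 == _]eq_sym. Qed.

Lemma rook_adj_irr n : irreflexive (@rook_adj n).
Proof. by move=> u; rewrite /rook_adj !eqxx. Qed.

(* The Cartesian product K_n x K_n. *)
Definition K2 (n : nat) : sgraph := SGraph (@rook_adj_sym n) (@rook_adj_irr n).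

(* Main.v *)
Require Import Defs.
From mathcomp Require Import all_boot all_algebra.

(** The vertices of a row are pairwise adjacent, so their color sets are
pairwise disjoint and [t * n] colors are needed. Conversely, give the cell
[(i, j)] the colors [(k, L k i j)]: the Latin property makes the color sets of
adjacent cells disjoint, and orthogonality lets distinct cells share at most
one color. *)

(** Bounding every walk avoids any connectivity argument: if no walk exists, the distance is [None]
    and the bound holds by convention. *)
Lemma lt_dist_gdist (G : sgraph) (u v : vertex G) (m : nat) :
  (forall k, has_walk u v k -> m < k) -> lt_dist m (gdist u v).
Proof.
by move=> mlt; rewrite /gdist; case: decP => //= uv; case: ex_minnP => k /mlt.
Qed.

(** The edge itself is a walk of length 1, so the distance is at most 1. *)
Lemma gdist_adj (G : sgraph) (u v : vertex G) (m : nat) :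
  adj u v -> lt_dist m (gdist u v) -> m = 0.
Proof.
move=> uv; rewrite /gdist; case: decP => [w|[]]; last exact: connect1.
case: ex_minnP => k _ /(_ 1) /= kle1 mk.
suff /kle1 k1 : has_walk u v 1.
  by apply/eqP; rewrite -leqn0 -ltnS (leq_trans mk k1).
by apply/existsP; exists [tuple v]; rewrite /= uv eqxx.
Qed.

Lemma has_walk0 (G : sgraph) (u v : vertex G) : has_walk u v 0 -> u = v.
Proof. by case/existsP => p; rewrite tuple0 /= => /eqP. Qed.

Lemma has_walk1 (G : sgraph) (u v : vertex G) : has_walk u v 1 -> adj u v.
Proof.
by case/existsP => p; case/tupleP: p => x p; rewrite tuple0 /= andbT => /andP[ux /eqP <-].
Qed.

Lemma tone_colorable_K2_ge (n t k : nat) :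
  0 < n -> tone_colorable (K2 n) t k -> t * n <= k.
Proof.
move=> hn /existsP[f /andP[/forallP ft /forallP fd]].
pose i0 : 'I_n := Ordinal hn.
pose F (j : 'I_n) := f ((i0, j) : vertex (K2 n)).
have disjF i j : i != j -> [disjoint F i & F j].
  move=> ij; rewrite -setI_eq0 -cards_eq0; apply/eqP.
  apply: (@gdist_adj (K2 n) (i0, i) (i0, j)).
    by rewrite /= /rook_adj /= ij.
  have /forallP/(_ (i0, j))/implyP := fd (i0, i); apply.
  by apply/eqP => -[/eqP]; rewrite (negPf ij).
have <- : \sum_(j < n) #|F j| = t * n.
  under eq_bigr => j _ do rewrite (eqP (ft (i0, j))).
  by rewrite sum_nat_const card_ord mulnC.
(* As sums of ones over disjoint sets, the cardinals merge into a single sum over the union, a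
   subset of the [k] colors. *)
under eq_bigr => j _ do rewrite -sum1_card.
rewrite -partition_disjoint_bigcup //= sum1_card.
by rewrite -[leqRHS]card_ord max_card.
Qed.

Definition mols_coloring {n t : nat} (L : 'I_t -> 'M['I_n]_n) :
    {ffun vertex (K2 n) -> {set 'I_t * 'I_n}} :=
  [ffun v => [set (k, L k v.1 v.2) | k : 'I_t]].

Lemma mem_mols_coloring {n t : nat} (L : 'I_t -> 'M['I_n]_n) v c :
  (c \in mols_coloring L v) = (L c.1 v.1 v.2 == c.2).
Proof.
rewrite ffunE; apply/imsetP/eqP => [[k _ ->] //|e].
by exists c.1 => //; rewrite e; case: c {e}.
Qed.

(** A shared color [(k, s)] would make [s] occur twice in a row or column of [L k]. *)
Lemma mols_coloring_adj {n t : nat} (L : 'I_t -> 'M['I_n]_n) u v :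
  MOLS L -> rook_adj u v ->
  mols_coloring L u :&: mols_coloring L v = set0.
Proof.
move=> molsL uv; apply/setP => c; rewrite !inE !mem_mols_coloring.
apply/negP => /andP[/eqP cu /eqP cv].
case: molsL => latL _; case: (latL c.1) => rowL colL.
move: u v uv cu cv => [a b] [a' b']; rewrite /rook_adj /=.
case: (eqVneq a a') => [<-|aa'] /=.
  case: (rowL a c.2) => j [_ uj] bb' /uj e /uj e'.
  by rewrite -e -e' eqxx in bb'.
(* Cells that differ in both coordinates are not adjacent, which leaves a common column. *)
case: (eqVneq b b') => //= <- _.
by case: (colL b c.2) => i [_ ui] /ui e /ui e'; rewrite -e -e' eqxx in aa'.
Qed.

(** Shared colors with the same index [k] coincide, since the cell determines the symbol. With
    distinct indices [k] and [l], the cells [u] and [v] would carry the same pair of symbols in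
    [L k] and [L l]. *)
Lemma mols_coloring_le1 {n t : nat} (L : 'I_t -> 'M['I_n]_n) u v :
  MOLS L -> u != v -> #|mols_coloring L u :&: mols_coloring L v| <= 1.
Proof.
move=> molsL uv; apply/card_le1_eqP => -[k s] [l r].
rewrite !inE !mem_mols_coloring /= => /andP[/eqP ku /eqP kv] /andP[/eqP lu /eqP lv].
case: (eqVneq k l) => [kl|kl]; first by rewrite -ku -lu kl.
case: molsL => _ /(_ _ _ kl)/(_ u v) orth.
by case/eqP: uv; apply: orth; rewrite ku kv lu lv.
Qed.

Lemma mols_tone_coloring {n t : nat} (L : 'I_t -> 'M['I_n]_n) :
  MOLS L -> tone_coloring t (mols_coloring L).
Proof.
move=> molsL; apply/andP; split.
  apply/forallP => v; rewrite ffunE card_imset ?card_ord //.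
  by move=> k l [].
apply/forallP => u; apply/forallP => v; apply/implyP => uv.
(* Walks of length 0 are excluded by [u != v], those of length 1 force an empty intersection, and
   from length 2 on one common color is allowed. *)
apply: lt_dist_gdist => -[|[|k]].
- by move/has_walk0/eqP; rewrite (negPf uv).
- by move/has_walk1/(mols_coloring_adj _ _ _ molsL) ->; rewrite cards0.
- by move=> _; apply: leq_ltn_trans (mols_coloring_le1 _ _ _ molsL uv) _.
Qed.

Lemma mols_tone_colorable {n t : nat} (L : 'I_t -> 'M['I_n]_n) :
  MOLS L -> tone_colorable (K2 n) t (t * n).
Proof.
by move/mols_tone_coloring/tone_colorable_card; rewrite card_prod !card_ord.
Qed.

Theorem theorem1p16 (n t : nat) (hn : 0 < n) (ht : 0 < t)
    (hL : exists L : 'I_t -> 'M['I_n]_n, MOLS L) :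
  tone_number t (K2 n) = t * n.
Proof.
case: hL => L molsL; rewrite /tone_number; case: ex_minnP => k colk mink.
apply/eqP; rewrite eqn_leq mink ?(mols_tone_colorable L) //=.
exact: tone_colorable_K2_ge.
Qed.
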